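(* Let $\beta>0$ and let $G,a,V$ satisfy: (1) $G:\mathbb{R}\to[0,+\infty)$ is locally Lipschitz continuous and $\lim_{p\to\pm\infty}G(p)=+\infty$; (2) $G(0)=0$, $G_1:=G|_{(-\infty,0]}$ is strictly decreasing and $G_2:=G|_{[0,+\infty)}$ is strictly increasing; (3) $a:\mathbb{R}\times\Omega\to(0,1]$ and $V:\mathbb{R}\times\Omega\to[0,1]$ are stationary, i.e. $a(x,\omega)=a(0,\tau_x\omega)$ and $V(x,\omega)=V(0,\tau_x\omega)$ for every $(x,\omega)\in\mathbb{R}\times\Omega$; (4) $\inf_{x\in\mathbb{R}}V(x,\omega)=0$ and $\sup_{x\in\mathbb{R}}V(x,\omega)=1$ for $\mathbb{P}$-a.e. $\omega$; (5) $a(\cdot,\omega)$ and $V(\cdot,\omega)$ are continuous on $\mathbb{R}$ for every $\omega\in\Omega$. Then, for every $\lambda\ge\beta$ and $\omega\in\Omega$, the equation $$a(x,\omega)F''+G(F')+\beta V(x,\omega)=\lambda,\qquad x\in\mathbb{R},$$ has a unique solution $F_1^\lambda(\cdot,\omega)\in C^2(\mathbb{R})$ such that $$F_1^\lambda(0,\omega)=0\quad\text{and}\quad (F_1^\lambda)'(x,\omega)\in[G_1^{-1}(\lambda),G_1^{-1}(\lambda-\beta)]\ \text{ for all }x\in\mathbb{R}.$$ Similarly, it has a unique solution $F_2^\lambda(\cdot,\omega)\in C^2(\mathbb{R})$ such that $$F_2^\lambda(0,\omega)=0\quad\text{and}\quad (F_2^\lambda)'(x,\omega)\in[G_2^{-1}(\lambda-\beta),G_2^{-1}(\lambda)]\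 \text{ for all }x\in\mathbb{R}.$$ Moreover, $(F_1^\lambda)'$ and $(F_2^\lambda)'$ are stationary, i.e. $(F_i^\lambda)'(x,\omega)=(F_i^\lambda)'(0,\tau_x\omega)$ for every $i\in\{1,2\}$, $x\in\mathbb{R}$ and $\omega\in\Omega$.
   Context: $(\Omega,\mathcal{F},\mathbb{P})$ is a probability space equipped with a group of measure-preserving transformations $\tau_x:\Omega\to\Omega$, $x\in\mathbb{R}$ (so $\tau_0=\mathrm{id}$, $\tau_{x+y}=\tau_x\circ\tau_y$), such that $(x,\omega)\mapsto\tau_x\omega$ is measurable, and $\mathbb{P}$ is ergodic: $\mathbb{P}(A)\in\{0,1\}$ whenever $A\in\mathcal{F}$ satisfies $\tau_xA=A$ for all $x\in\mathbb{R}$. The functions $a(0,\cdot)$ and $V(0,\cdot)$ are measurable. $G_1^{-1}:[0,+\infty)\to(-\infty,0]$ and $G_2^{-1}:[0,+\infty)\to[0,+\infty)$ denote the inverses of $G_1$ and $G_2$. Primes denote derivatives in $x$. *)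

(* Defs.v *)
From mathcomp Require Import all_boot all_order all_algebra.
From mathcomp Require Import all_classical all_reals all_analysis.
Import Order.TTheory GRing.Theory Num.Theory.
Import numFieldNormedType.Exports.

Set Implicit Arguments.
Unset Strict Implicit.
Unset Printing Implicit Defensive.

Local Open Scope ring_scope.
Local Open Scope classical_set_scope.

Definition measure_preserving (R : realType) (d : measure_display)
    (Omega : measurableType d) (P : probability Omega R) (T : Omega -> Omega) :=
  measurable_fun setT T /\
  forall A, measurable A -> P (T @^-1` A) = P A.

(* Joint measurability is with respect to the product of the Borel
   sigma-algebra of R and the sigma-algebra of Omega. *)
Definition measurable_action (R : realType) (d : measure_display)
    (Omega : measurableType d) (tau : R -> Omega -> Omega) :=
  [/\ tau 0 = id,
      (forall x y, tau (x + y) = tau x \o tau y) &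
      measurable_fun setT (fun z : measurableTypeR R * Omega => tau z.1 z.2)].

Definition ergodic (R : realType) (d : measure_display)
    (Omega : measurableType d) (P : probability Omega R)
    (tau : R -> Omega -> Omega) :=
  forall A, measurable A -> (forall x, tau x @` A = A) ->
    P A = 0%E \/ P A = 1%E.

Definition stationary (R : realType) (Omega : Type)
    (tau : R -> Omega -> Omega) (f : R -> Omega -> R) :=
  forall x w, f x w = f 0 (tau x w).

(* The library's [locally [lipschitz _ | _ in _]] also constrains pairs of
   distinct base points, hence the explicit neighbourhood. *)
Definition locally_lipschitz (R : realType) (G : R -> R) :=
  forall p : R, exists2 U, nbhs p U & [lipschitz G q | q in U].

Definition C2 (R : realType) (F : R -> R) :=
  [/\ (forall x, derivable F x 1), (forall x, derivable F^`()%classic x 1) &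
      continuous F^`(2)].

(* Inverses of the restrictions of G to ]-oo, 0] and [0, +oo[; the values
   outside the images of these half-lines are irrelevant. *)
Definition G1inv (R : realType) (G : R -> R) : R -> R :=
  'pinv_(fun=> 0) `]-oo, 0] G.
Definition G2inv (R : realType) (G : R -> R) : R -> R :=
  'pinv_(fun=> 0) `[0, +oo[ G.

Definition solution (R : realType) (Omega : Type) (beta : R) (G : R -> R)
    (a V : R -> Omega -> R) (lambda : R) (w : Omega) (F : R -> R) :=
  C2 F /\
  forall x, a x w * F^`(2)%classic x + G (F^`()%classic x) + beta * V x w = lambda.

Definition F1_spec (R : realType) (Omega : Type) (beta : R) (G : R -> R)
    (a V : R -> Omega -> R) (lambda : R) (w : Omega) (F : R -> R) :=
  [/\ solution beta G a V lambda w F, F 0 = 0 &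
      forall x, F^`()%classic x \in `[G1inv G lambda, G1inv G (lambda - beta)]].

Definition F2_spec (R : realType) (Omega : Type) (beta : R) (G : R -> R)
    (a V : R -> Omega -> R) (lambda : R) (w : Omega) (F : R -> R) :=
  [/\ solution beta G a V lambda w F, F 0 = 0 &
      forall x, F^`()%classic x \in `[G2inv G (lambda - beta), G2inv G lambda]].

(* Main.v *)
(** With f = F', b = 1/a >= 1 and h = lambda - beta V, the equation is
    f' = b (h - G f), and the required strip [A, B] satisfies
    G A <= h <= G B (increasing branch); the decreasing branch is the
    reflection x |-> - f (- x) of this case.

    Existence.  If K is a Lipschitz constant of G on [A, B], then
    q |-> K q - G q is nondecreasing there.  The map T sending f to the only
    solution u in [A, B] of the linear equation u' = b (h + K f - G f - K u) is
    thus monotone, and |T f y - T f x| <= K (B - A) |Phi y - Phi x| for a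
    primitive Phi of b.  As in the Knaster-Tarski theorem, the supremum of all
    f with f <= T f is a fixed point of T; the common modulus makes it
    continuous, which is what T needs of its argument.

    Uniqueness.  For two solutions f and g in the strip,
    ((f - g)^2)' = - 2 b (f - g) (G f - G g) <= 0.  If f and g differ at x0,
    then |f - g| is bounded below on ]-oo, x0], so this derivative is bounded
    away from 0 there and (f - g)^2 is unbounded at -oo, a contradiction.

    Stationarity follows from uniqueness, since translating a solution for w
    by x gives a solution for tau x w. *)

Require Import Defs.
From mathcomp Require Import all_boot all_order all_algebra.
From mathcomp Require Import all_classical all_reals all_analysis.
From mathcomp Require Import ring lra.
Import Order.TTheory GRing.Theory Num.Theory.
Import numFieldNormedType.Exports.

Set Implicit Arguments.
Unset Strict Implicit.
Unset Printing Implicit Defensive.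

Local Open Scope ring_scope.
Local Open Scope classical_set_scope.

(** * Derivatives, monotonicity and primitives on the real line *)

Lemma is_derive_continuous (R : realType) (f df : R -> R) :
  (forall x : R, is_derive x 1 f (df x)) -> continuous f.
Proof.
by move=> fdf x; apply/differentiable_continuous/derivable1_diffP/ex_derive.
Qed.

Lemma is_derive_homo (R : realType) (f df : R -> R) :
  (forall x : R, is_derive x 1 f (df x)) -> (forall x, 0 <= df x) ->
  {homo f : x y / x <= y}.
Proof.
move=> fdf df_ge0 x y xy.
have cf := continuous_subspaceT (is_derive_continuous fdf).
have [c _ E] := MVT_segment xy (fun z _ => fdf z) (cf _).
by rewrite -subr_ge0 E mulr_ge0// subr_ge0.
Qed.

Lemma exists_primitive (R : realType) (g : R -> R) : continuous g ->
  exists J : R -> R, J 0 = 0 /\ forall x : R, is_derive x 1 J (g x).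
Proof.
move=> cg.
pose mu := @lebesgue_measure R.
have ig a b : mu.-integrable `[a, b] (EFin \o g).
  by apply: continuous_compact_integrable;
    [exact: segment_compact | exact: continuous_subspaceT].
pose S a x : R := \int[mu]_(t in `[a, x]) g t.
(* Signed integral from 0 to [x]: at least one of the two half-open intervals is empty. *)
pose J x : R := \int[mu]_(t in `]0, x]) g t - \int[mu]_(t in `]x, 0]) g t.
have JE a x : a < 0 -> a < x -> J x = S a x - S a 0.
  move=> a0 ax; rewrite /J /S; have [x0|x0] := leP 0 x.
    rewrite (@Rintegral_itvB _ g (BLeft a) (BRight x) 0) ?bnd_simp ?(ltW a0)//.
    by rewrite [in X in _ - X]set_itv_ge ?bnd_simp -?leNgt// Rintegral_set0 subr0.
  rewrite -[RHS]opprB.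
  rewrite (@Rintegral_itvB _ g (BLeft a) (BRight 0) x) ?bnd_simp ?(ltW ax) ?ltW//.
  rewrite [in X in X - _]set_itv_ge ?bnd_simp -?leNgt ?(ltW x0)//.
  by rewrite Rintegral_set0 sub0r.
exists J; split; first by rewrite (JE (-1) 0) ?subrr// ltrN10.
(* Both [x] and 0 lie to the right of [a], so [JE] holds for all [y] near [x] and the fundamental
   theorem applies to [S a], whatever the sign of [x]. *)
move=> x; pose a : R := Num.min x 0 - 1.
have [ax a0] : a < x /\ a < 0.
  by split; rewrite /a ltrBlDr gt_min ltrDl ltr01 ?orbT.
apply: (@near_eq_is_derive _ _ _ (fun y => S a y - S a 0)).
  near=> y; rewrite -JE//; near: y; exact: lt_nbhsr.
have [dS SE] : derivable (S a) x 1 /\ (S a)^`() x = g x.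
  apply: (@continuous_FTC1_closed _ g a x (x + 1)) => //; first by rewrite ltrDl.
  exact: cg.
have dSa : is_derive x (1 : R) (S a) (g x).
  by apply: DeriveDef; [exact: dS | rewrite -derive1E SE].
by have := is_deriveB dSa (is_derive_cst (S a 0) x 1); rewrite subr0.
Unshelve. all: by end_near. Qed.

(** * The linear equation u' = b (g - K u) *)

Lemma is_derive_integrating_factor (R : realType) (K : R) (b Phi : R -> R) :
  (forall x : R, is_derive x 1 Phi (b x)) ->
  forall x : R, is_derive x 1 (fun y => expR (K * Phi y))
    (K * b x * expR (K * Phi x)).
Proof.
move=> dPhi x; have := dPhi x => dPhix.
have dK := is_deriveZ K dPhix.
have := @is_derive1_comp R expR (K *: Phi) x _ _ (is_derive_expR _) dK.
by move=> d; apply: (is_derive_eq d); rewrite /= mulrC.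
Qed.

(** With Phi' = b and E = exp (K Phi), the equation becomes (E u)' = E b g = J', so u = (c + J) / E
    for a constant c, and A <= u <= B means A E - J <= c <= B E - J. The bounds on [g] make such a c
    exist. *)
Lemma linear_bounded_solution (R : realType) (K A B : R) (b g : R -> R) :
  0 < K -> (forall x, 0 <= b x) -> continuous b -> continuous g ->
  (forall x, K * A <= g x <= K * B) ->
  exists u : R -> R,
    (forall x : R, is_derive x 1 u (b x * (g x - K * u x))) /\
    forall x, A <= u x <= B.
Proof.
move=> K0 b0 cb cg gAB.
have [Phi [_ dPhi]] := exists_primitive cb.
pose E x := expR (K * Phi x).
have dE x : is_derive x (1 : R) E (K * b x * E x).
  exact: is_derive_integrating_factor.
have cE : continuous E := is_derive_continuous dE.
have E0 x : 0 < E x by exact: expR_gt0.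
have [J [J0 dJ]] : exists J : R -> R, J 0 = 0 /\
    forall x : R, is_derive x 1 J (E x * (b x * g x)).
  apply: exists_primitive => x.
  exact: continuousM (cE x) (continuousM (cb x) (cg x)).
have lo : {homo (J - A *: E) : x y / x <= y}.
  apply: (is_derive_homo (fun x => is_deriveB (dJ x) (is_deriveZ A (dE x)))) => x /=.
  have /andP[gA _] := gAB x.
  have -> : E x * (b x * g x) - A *: (K * b x * E x) =
    E x * b x * (g x - K * A) by rewrite /GRing.scale /=; ring.
  by rewrite !mulr_ge0 ?subr_ge0// ltW.
have hi : {homo (B *: E - J) : x y / x <= y}.
  apply: (is_derive_homo (fun x => is_deriveB (is_deriveZ B (dE x)) (dJ x))) => x /=.
  have /andP[_ gB] := gAB x.
  have -> : B *: (K * b x * E x) - E x * (b x * g x) =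
    E x * b x * (K * B - g x) by rewrite /GRing.scale /=; ring.
  by rewrite !mulr_ge0 ?subr_ge0// ltW.
have AB : A <= B.
  by rewrite -(ler_pM2l K0); have /andP[+ ] := gAB 0; exact: le_trans.
(* A E - J is nonincreasing and B E - J is nondecreasing: compare them at
   min(x, y). Any c separating the two ranges makes (c + J) / E a solution in
   [A, B], without integrating over ]-oo, x]. *)
have sep x y : A * E x - J x <= B * E y - J y.
  have lox z : z <= x -> A * E x - J x <= A * E z - J z.
    by move=> /lo; rewrite /= -lerN2 !opprB.
  have hiy z : z <= y -> B * E z - J z <= B * E y - J y by move=> /hi.
  apply: (@le_trans _ _ (A * E (Num.min x y) - J (Num.min x y))).
    by apply: lox; rewrite ge_min lexx.
  apply: (@le_trans _ _ (B * E (Num.min x y) - J (Num.min x y))).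
    by rewrite lerD2r ler_pM2r.
  by apply: hiy; rewrite ge_min lexx orbT.
pose c := sup (range (fun x => A * E x - J x)).
have c_lo x : A * E x - J x <= c.
  apply: ub_le_sup; last by exists x.
  by exists (B * E 0 - J 0) => _ [z _ <-].
have c_hi y : c <= B * E y - J y.
  apply: ge_sup; first by exists (A * E 0 - J 0), 0.
  by move=> _ [z _ <-].
(* [N] is 1 / E, written as an exponential so that the derivative lemma applies to it with - K in
   place of K. *)
pose N x := expR (- K * Phi x).
have dN x : is_derive x (1 : R) N (- K * b x * N x).
  exact: is_derive_integrating_factor.
have NE x : N x * E x = 1 by rewrite /N /E -expRD mulNr addNr expR0.
have N0 x : 0 < N x by exact: expR_gt0.
clearbody E N c.
exists (N * (cst c + J)); split=> x.
  have d := is_deriveM (dN x) (is_deriveD (is_derive_cst c x 1) (dJ x)).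
  apply: (is_derive_eq d); rewrite /GRing.scale /= fctE /= fctE add0r.
  by ring: (NE x).
have -> : (N * (cst c + J)) x = N x * (c + J x) by [].
have EK z : z = N x * (z * E x) by rewrite mulrCA NE mulr1.
by apply/andP; split; [rewrite [leLHS]EK | rewrite [leRHS]EK];
  rewrite ler_pM2l//; [have := c_lo x | have := c_hi x]; lra.
Qed.

(** Boundedness on the whole line takes the place of an initial condition. This gives the
    monotonicity of the map T and, for [g1] = [g2], the uniqueness of its value. *)
Lemma linear_comparison (R : realType) (K A B : R) (b g1 g2 u1 u2 : R -> R) :
  0 < K -> (forall x, 1 <= b x) -> continuous b ->
  (forall x, g1 x <= g2 x) ->
  (forall x : R, is_derive x 1 u1 (b x * (g1 x - K * u1 x))) ->
  (forall x : R, is_derive x 1 u2 (b x * (g2 x - K * u2 x))) ->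
  (forall x, A <= u1 x <= B) -> (forall x, A <= u2 x <= B) ->
  forall x, u1 x <= u2 x.
Proof.
move=> K0 b1 cb g12 du1 du2 u1AB u2AB x0.
have [Phi [Phi0 dPhi]] := exists_primitive cb.
pose E x := expR (K * Phi x).
have E0 x : 0 < E x by exact: expR_gt0.
have dE x : is_derive x (1 : R) E (K * b x * E x).
  exact: is_derive_integrating_factor.
(* E (u2 - u1) is nondecreasing and tends to 0 at -oo, because b >= 1 gives
   E x <= exp (K x) for x <= 0. *)
have mono : {homo (E * (u2 - u1)) : x y / x <= y}.
  apply: (is_derive_homo (fun x => is_deriveM (dE x) (is_deriveB (du2 x) (du1 x)))) => x /=.
  rewrite /GRing.scale /= !fctE.
  have -> : E x * (b x * (g2 x - K * u2 x) - b x * (g1 x - K * u1 x)) +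
    (u2 x - u1 x) * (K * b x * E x) = E x * b x * (g2 x - g1 x) by ring.
  by rewrite !mulr_ge0 ?subr_ge0// ?ltW// (lt_le_trans ltr01).
have Phi_le : {homo (Phi - id) : x y / x <= y}.
  apply: (is_derive_homo (fun x => is_deriveB (dPhi x) (is_derive_id x 1))) => x /=.
  by rewrite subr_ge0.
rewrite leNgt; apply/negP => lt21.
pose e := E x0 * (u1 x0 - u2 x0).
have e0 : 0 < e by rewrite mulr_gt0// subr_gt0.
have M0 : 0 < B - A.
  have := u1AB x0; have := u2AB x0; lra.
have e_le x : x <= x0 -> x <= 0 -> e <= expR (K * x) * (B - A).
  move=> xx0 x_le0.
  have h : e <= E x * (u1 x - u2 x).
    by have := mono _ _ xx0; rewrite !fctE /e; lra.
  apply: (le_trans h); apply: (@le_trans _ _ (E x * (B - A))).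
    by rewrite ler_pM2l//; have := u1AB x; have := u2AB x; lra.
  rewrite ler_pM2r// ler_expR ler_pM2l//.
  by have := Phi_le _ _ x_le0; rewrite !fctE Phi0; lra.
(* The point - s / K lies to the left of both [x0] and 0, and there [e_le] gives e <= exp (- s) (B -
   A). This fails because exp s >= 1 + s > (B - A) / e. *)
pose s := Num.max ((B - A) / e) (K * `|x0|).
have s0 : 0 <= s by rewrite le_max (divr_ge0 (ltW M0) (ltW e0)).
have /e_le : - (s / K) <= x0.
  have : K * `|x0| <= s by rewrite le_max lexx orbT.
  rewrite mulrC -ler_pdivlMr// => h; rewrite lerNl (le_trans _ h)//.
  by rewrite -normrN ler_norm.
rewrite oppr_le0 divr_ge0 ?(ltW K0)// => /(_ isT).
rewrite mulrN mulrCA divff ?gt_eqF// mulr1 expRN leNgt mulrC.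
rewrite ltr_pdivrMr ?expR_gt0// -ltr_pdivrMl//.
rewrite mulrC => /negP; apply; apply: lt_le_trans (expR_ge1Dx s).
have : (B - A) / e <= s by rewrite le_max lexx.
lra.
Qed.

(** * Existence and uniqueness for the nonlinear first-order equation in a strip *)

Definition bounded_profile (R : realType) (b h G : R -> R) (A B : R)
    (f : R -> R) :=
  (forall x : R, is_derive x 1 f (b x * (h x - G (f x)))) /\
  forall x, A <= f x <= B.

Lemma bounded_profile_exists (R : realType) (b h G : R -> R) (K A B : R) :
  0 < K -> A <= B -> (forall x, 1 <= b x) -> continuous b -> continuous h ->
  continuous G ->
  (forall p q, A <= p -> p <= q -> q <= B -> G q - G p <= K * (q - p)) ->
  (forall x, G A <= h x <= G B) ->
  exists f, bounded_profile b h G A B f.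
Proof.
move=> K0 AB b1 cb ch cG lipG hAB.
have b0 x : 0 <= b x by exact: le_trans (b1 x).
have [Phi [_ dPhi]] := exists_primitive cb.
have cPhi := is_derive_continuous dPhi.
pose rhs (f : R -> R) x := h x + K * f x - G (f x).
have rhs_cont f : continuous f -> continuous (rhs f).
  move=> cf x; apply: cvgB; last exact: (continuous_comp (cf x) (cG _)).
  exact: cvgD (ch x) (cvgM (cvg_cst K) (cf x)).
have rhs_homo f1 f2 : (forall x, A <= f1 x <= B) -> (forall x, A <= f2 x <= B) ->
    (forall x, f1 x <= f2 x) -> forall x, rhs f1 x <= rhs f2 x.
  move=> f1AB f2AB f12 x.
  have /andP[f1A _] := f1AB x; have /andP[_ f2B] := f2AB x.
  by have := lipG _ _ f1A (f12 x) f2B; rewrite /rhs; lra.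
(* [rhs] is monotone in [f], is at least K A at the constant A since G A <= h, and is at most K B at
   the constant B since h <= G B. *)
have rhs_bounds f : (forall x, A <= f x <= B) ->
    forall x, K * A <= rhs f x <= K * B.
  move=> fAB x; have /andP[fA fB] := fAB x; have := hAB x.
  have := lipG _ _ (lexx A) fA fB; have := lipG _ _ fA fB (lexx B).
  rewrite /rhs; lra.
(* The map T is encoded as a relation, so no solution has to be chosen; [T_homo] with [f1] = [f2]
   makes it single-valued. *)
pose T (f u : R -> R) :=
  (forall x : R, is_derive x 1 u (b x * (rhs f x - K * u x))) /\
  forall x, A <= u x <= B.
have T_exists f : continuous f -> (forall x, A <= f x <= B) -> exists u, T f u.
  move=> cf fAB; apply: linear_bounded_solution => //; first exact: rhs_cont.
  exact: rhs_bounds.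
have T_homo f1 f2 u1 u2 : (forall x, A <= f1 x <= B) ->
    (forall x, A <= f2 x <= B) -> (forall x, f1 x <= f2 x) ->
    T f1 u1 -> T f2 u2 -> forall x, u1 x <= u2 x.
  move=> f1AB f2AB f12 [du1 u1AB] [du2 u2AB].
  by apply: linear_comparison du1 du2 u1AB u2AB => //; exact: rhs_homo.
(* Both [rhs f] and K u lie in [K A, K B], so they differ by at most [M]. The resulting modulus is
   the same for all [f]; it is measured by [Phi] because [b] may be unbounded. *)
pose M := K * (B - A).
have T_modulus f u : (forall x, A <= f x <= B) -> T f u ->
    forall x y, u y - u x <= M * `|Phi y - Phi x|.
  move=> fAB [du uAB].
  have slope x : - M <= rhs f x - K * u x <= M.
    have /andP[uA uB] := uAB x; have /andP[gA gB] := rhs_bounds f fAB x.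
    have KA : K * A <= K * u x by rewrite ler_pM2l.
    have KB : K * u x <= K * B by rewrite ler_pM2l.
    by rewrite /M; apply/andP; split; lra.
  have up : {homo (M *: Phi - u) : x y / x <= y}.
    apply: (is_derive_homo (fun x => is_deriveB (is_deriveZ M (dPhi x)) (du x))).
    move=> x; have /andP[_ s] := slope x.
    rewrite /GRing.scale /= mulrC -mulrBr mulr_ge0// subr_ge0//.
  have dn : {homo (M *: Phi + u) : x y / x <= y}.
    apply: (is_derive_homo (fun x => is_deriveD (is_deriveZ M (dPhi x)) (du x))).
    move=> x; have /andP[s _] := slope x.
    rewrite /GRing.scale /= mulrC -mulrDr mulr_ge0// -lerBlDl sub0r//.
  have M0 : 0 <= M by rewrite mulr_ge0 ?subr_ge0// ltW.
  move=> x y; have [xy|/ltW yx] := leP x y.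
    apply: (@le_trans _ _ (M * (Phi y - Phi x))).
      by have := up _ _ xy; rewrite !fctE /GRing.scale /=; lra.
    by rewrite ler_wpM2l// ler_norm.
  apply: (@le_trans _ _ (M * (Phi x - Phi y))).
    by have := dn _ _ yx; rewrite !fctE /GRing.scale /=; lra.
  by rewrite ler_wpM2l// distrC ler_norm.
pose S : set (R -> R) := [set f | [/\ continuous f, (forall x, A <= f x <= B) &
  exists2 u, T f u & forall x, f x <= u x]].
have SA : S (cst A).
  have cAB (x : R) : A <= cst A x <= B by rewrite /= lexx.
  have [u Tu] := T_exists _ (@cst_continuous _ _ A) cAB.
  split=> //; first exact: cst_continuous.
  by exists u => // x; have /andP[] := Tu.2 x.
have ST f u : S f -> T f u -> S u.
  move=> [cf fAB [u' Tu' fu']] Tu.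
  have cu := is_derive_continuous Tu.1.
  have [v Tv] := T_exists u cu Tu.2.
  split=> //; first exact: Tu.2.
  exists v => // x; apply: (T_homo f u u v) => // y; first exact: Tu.2.
  apply: le_trans (fu' y) _; apply: (T_homo f f) => //.
pose F x := sup [set f x | f in S].
have supS x : has_sup [set f x | f in S].
  split; first by exists A, (cst A).
  by exists B => _ [f [_ fAB _] <-]; have /andP[] := fAB x.
have F_ub f x : S f -> f x <= F x.
  by move=> Sf; apply: sup_upper_bound => //; exists f.
have F_lub x z : (forall f, S f -> f x <= z) -> F x <= z.
  move=> Hz; apply: ge_sup; first exact: (supS x).1.
  by move=> _ [f Sf <-]; exact: Hz.
have FAB x : A <= F x <= B.
  rewrite (F_ub (cst A) x SA) /=; apply: F_lub => f [_ fAB _].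
  by have /andP[] := fAB x.
(* The members of [S] share no modulus, but their images under T do, and these are again in [S]: f y
   <= u y <= u x + M |Phi y - Phi x| <= F x + M |Phi y - Phi x|. *)
have F_modulus x y : F y - F x <= M * `|Phi y - Phi x|.
  rewrite lerBlDr; apply: F_lub => f Sf.
  have [cf fAB [u Tu fu]] := Sf.
  have := T_modulus f u fAB Tu x y; have := fu y.
  have := F_ub u x (ST f u Sf Tu); lra.
have cF : continuous F.
  move=> x; apply/cvgrPdist_le => /= e e0.
  (* Dividing by M + 1 rather than by M covers the case A = B, where M = 0. *)
  have M1 : 0 < M + 1 by rewrite ltr_wpDl// mulr_ge0 ?subr_ge0// ltW.
  have /cvgrPdist_le /(_ (e / (M + 1))) := cPhi x.
  rewrite divr_gt0// => /(_ isT); apply: filterS => y Pxy.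
  have le_e : M * `|Phi x - Phi y| <= e.
    apply: (@le_trans _ _ ((M + 1) * `|Phi x - Phi y|)).
      by rewrite ler_wpM2r// lerDl.
    by rewrite mulrC -ler_pdivlMr.
  rewrite ler_norml lerNl opprB.
  by rewrite !(le_trans (F_modulus _ _))// distrC.
(* Each f in [S] satisfies f <= T f <= T F = U, hence F <= U and F is in [S]. Then U is in [S] too,
   which gives U <= F. *)
have [U TU] := T_exists F cF FAB.
have FU x : F x <= U x.
  apply: F_lub => f Sf; have [cf fAB [u Tu fu]] := Sf.
  apply: le_trans (fu x) _; apply: (T_homo f F) => // y.
  exact: F_ub.
have SF : S F by split=> //; exists U.
have UF x : U x = F x by apply/eqP; rewrite eq_le FU F_ub//; exact: ST TU.
exists F; split=> // x.
have -> : F = U by apply/funext => y; rewrite UF.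
have := TU.1 x; rewrite /rhs UF => d; apply: (is_derive_eq d).
by ring.
Qed.

Lemma bounded_profile_unique (R : realType) (b h G : R -> R) (A B : R)
    (f g : R -> R) :
  (forall x, 1 <= b x) -> continuous G ->
  (forall p q, A <= p -> p < q -> q <= B -> G p < G q) ->
  bounded_profile b h G A B f -> bounded_profile b h G A B g -> f = g.
Proof.
move=> b1 cG incG [df fAB] [dg gAB]; apply/funext => x0; apply/eqP.
apply/negPn/negP => fg0.
pose w x := f x - g x.
pose D x := b x * (w x * (G (f x) - G (g x))).
have dw (x : R) : is_derive x 1 (w * w) (- (2 * D x)).
  have dwx := is_deriveB (df x) (dg x).
  apply: (is_derive_eq (is_deriveM dwx dwx)).
  by rewrite /GRing.scale /= /D /w !fctE; ring.
pose d := `|w x0|.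
have d0 : 0 < d by rewrite normr_gt0 subr_eq0.
have dAB : d <= B - A.
  by rewrite ler_norml /w; have := fAB x0; have := gAB x0; lra.
(* Strict monotonicity becomes quantitative by compactness: [c] is d times the minimum of G (p + d)
   - G p over p in [A, B - d], which is positive. *)
have [c c0 Hc] : exists2 c, 0 < c & forall p q, A <= p <= B -> A <= q <= B ->
    d <= `|p - q| -> c <= (p - q) * (G p - G q).
  have [||p0] := @EVT_min R (fun p => G (p + d) - G p) A (B - d).
  - lra.
  - apply: continuous_subspaceT => p; apply: cvgB; last exact: cG.
    apply: (@continuous_comp _ _ _ (fun p => p + d) G); last exact: cG.
    exact: cvgD cvg_id (cvg_cst d).
  rewrite in_itv /= => /andP[p0A p0B] minp.
  exists (d * (G (p0 + d) - G p0)).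
    by rewrite mulr_gt0// subr_gt0 incG ?ltrDl//; lra.
  have main p q : A <= p <= B -> A <= q <= B -> d <= q - p ->
      d * (G (p0 + d) - G p0) <= (q - p) * (G q - G p).
    move=> pAB qAB dpq; apply: ler_pM => //; first exact: ltW.
      by rewrite subr_ge0 ltW// incG ?ltrDl//; lra.
    apply: le_trans (minp p _) _; first by rewrite in_itv /=; lra.
    rewrite lerD2r; have [->//|neq] := eqVneq q (p + d).
    by rewrite ltW// incG//; [lra | rewrite lt_neqAle eq_sym neq; lra | lra].
  move=> p q pAB qAB; have [pq|qp] := leP p q.
    rewrite distrC => dpq; rewrite -[leRHS]mulrNN !opprB; apply: main => //.
    by rewrite -(ger0_norm (_ : 0 <= q - p))// subr_ge0.
  by move=> dpq; apply: main => //; rewrite -(gtr0_norm (_ : 0 < p - q))// subr_gt0.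
have homG p q : A <= p <= B -> A <= q <= B -> p <= q -> G p <= G q.
  move=> /andP[Ap _] /andP[_ qB]; rewrite le_eqVlt => /predU1P[->//|pq].
  by rewrite ltW// incG.
have D_ge0 x : 0 <= D x.
  rewrite /D mulr_ge0 ?(le_trans _ (b1 x))// /w; have [fg|gf] := leP (f x) (g x).
    by rewrite -mulrNN !opprB mulr_ge0 ?subr_ge0// homG.
  by rewrite mulr_ge0 ?subr_ge0 ?homG// ltW.
have w2_le x : x <= x0 -> w x0 * w x0 <= w x * w x.
  move=> xx0; rewrite -lerN2.
  apply: (is_derive_homo (fun y => is_deriveN (dw y))) => // y.
  by rewrite opprK mulr_ge0.
have D_ge x : x <= x0 -> c <= D x.
  move=> xx0; apply: (@le_trans _ _ (w x * (G (f x) - G (g x)))).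
    apply: Hc => //; rewrite -/(w x) -(@ler_pXn2r _ 2) ?nnegrE// ?normr_ge0// /d.
    by rewrite !real_normK ?num_real// !expr2 w2_le.
  rewrite /D ler_peMl//; have := D_ge0 x; rewrite /D pmulr_rge0//.
  exact: lt_le_trans (b1 x).
(* Moving left from [x0] by t + 1 raises w^2 by at least 2 (t + 1) c = 2 ((B - A)^2 + c), by the
   mean value theorem, whereas w^2 <= (B - A)^2 in the strip. *)
pose t := (B - A) * (B - A) / c.
have t0 : 0 <= t by rewrite divr_ge0 ?(ltW c0)// -expr2 sqr_ge0.
have xx0 : x0 - (t + 1) < x0 by rewrite gtrBl ltr_wpDl.
have [xi] := MVT xx0 (fun y _ => dw y)
  (continuous_subspaceT (is_derive_continuous dw)).
rewrite in_itv /= => /andP[_ /ltW /D_ge cD].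
rewrite !fctE subKr => E.
have : (t + 1) * c <= (t + 1) * D xi by rewrite ler_wpM2l// addr_ge0.
have -> : (t + 1) * c = (B - A) * (B - A) + c.
  by rewrite mulrDl mul1r /t divfK// gt_eqF.
set y := x0 - (t + 1) in E xx0 *.
have : w y * w y <= (B - A) * (B - A).
  have wy : `|w y| <= B - A.
    by rewrite ler_norml /w; have := fAB y; have := gAB y; lra.
  rewrite -!expr2 -real_normK ?num_real// ler_pXn2r ?nnegrE//.
  exact: le_trans wy.
have : 0 <= w x0 * w x0 by rewrite -expr2 sqr_ge0.
have : 0 <= (t + 1) * D xi by rewrite mulr_ge0// addr_ge0.
lra.
Qed.

(** * From local Lipschitz continuity to Lipschitz bounds on segments *)

Lemma locally_lipschitz_near (R : realType) (G : R -> R) :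
  locally_lipschitz G -> forall p : R,
  exists2 U : set R, nbhs p U & \forall M \near +oo,
  forall x y, U x -> U y -> `|G x - G y| <= M * `|x - y|.
Proof.
move=> lipG p; have [U Up GU] := lipG p; exists U => //.
move: GU; rewrite /lipschitz_on; apply: filterS => M MU x y Ux Uy.
exact: (MU (x, y)).
Qed.

Lemma locally_lipschitz_continuous (R : realType) (G : R -> R) :
  locally_lipschitz G -> continuous G.
Proof.
move=> lipG p; have [U Up GU] := locally_lipschitz_near lipG p.
have [M [M0 MU]] : exists M, 0 < M /\
    forall x y, U x -> U y -> `|G x - G y| <= M * `|x - y|.
  near (pinfty_nbhs R) => M; exists M; split; near: M => //.
  exact: nbhs_pinfty_gt.
apply/cvgrPdist_le => /= e e0.
have pU := nbhs_singleton Up.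
near=> x; apply: (@le_trans _ _ (M * `|p - x|)).
  by apply: MU => //; near: x.
rewrite mulrC -ler_pdivlMr//; near: x.
by apply: (@cvgr_dist_le _ _ _ _ _ id); [exact: cvg_id | rewrite divr_gt0].
Unshelve. all: by end_near. Qed.

(** Compactness is applied to the square of the segment. Near a diagonal point the local Lipschitz
    bound serves; near any other point |p - q| is bounded below, so every large K works. The
    covering argument yields a common K. *)
Lemma locally_lipschitz_segment (R : realType) (G : R -> R) (A B : R) :
  locally_lipschitz G ->
  exists K, 0 < K /\ forall p q, A <= p <= B -> A <= q <= B ->
    `|G p - G q| <= K * `|p - q|.
Proof.
move=> lipG; have cG := locally_lipschitz_continuous lipG.
have /compact_near_coveringP/(_ R +oo
    (fun K z => `|G z.1 - G z.2| <= K * `|z.1 - z.2|)) :=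
  compact_setX (@segment_compact R A B) (@segment_compact R A B).
move=> /(_ _ _)[].
  move=> [p q] _; have [<-|pq] := eqVneq p q.
    have [U Up GU] := locally_lipschitz_near lipG p.
    exists (U `*` U, [set M | forall x y, U x -> U y ->
      `|G x - G y| <= M * `|x - y|]) => /=.
      by split => //; exists (U, U).
    by move=> [[x y] M] [[/= Ux Uy] MU]; exact: MU.
  (* Close to (p, q) the increment of [G] is at most |G p - G q| + 1 and the distance is at least
     [m], so K >= (|G p - G q| + 1) / m suffices. *)
  have pq0 : 0 < `|p - q| by rewrite normr_gt0 subr_eq0.
  pose m := `|p - q| / 2.
  have m0 : 0 < m by rewrite divr_gt0.
  have dist_cont (f : R -> R) : continuous f ->
      (fun z : R * R => `|f z.1 - f z.2|) @ (p, q) --> `|f p - f q|.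
    move=> cf; apply: cvg_norm; apply: cvgB.
      by apply: (@cvg_comp _ _ _ fst f _ (nbhs p)) (cf p); exact: cvg_fst.
    by apply: (@cvg_comp _ _ _ snd f _ (nbhs q)) (cf q); exact: cvg_snd.
  near=> z K => /=.
  apply: (@le_trans _ _ (`|G p - G q| + 1)).
    near: z; apply: (@cvgr_le _ _ _ _ _ _ (dist_cont G cG)).
    by rewrite ltrDl.
  apply: (@le_trans _ _ (K * m)).
    by rewrite -ler_pdivrMr//; near: K; exact: nbhs_pinfty_ge.
  rewrite ler_wpM2l//; near: z.
  have m_lt : m < `|p - q| by rewrite ltr_pdivrMr// ltr_pMr// ltr1n.
  exact: (@cvgr_ge _ _ _ _ _ _ (dist_cont id (fun x => @cvg_id _ _)) _ m_lt).
move=> K0 [_ HK]; exists (Num.max K0 0 + 1); split.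
  by rewrite ltr_wpDl// le_max lexx orbT.
move=> p q pAB qAB; apply: (HK (Num.max K0 0 + 1) _ (p, q)) => //.
  by rewrite ltr_pwDr// le_max lexx.
Unshelve. all: by end_near. Qed.

(** * Inverses of the two branches of [G] *)

Lemma exists_nonneg_preimage (R : realType) (G : R -> R) (y : R) :
  continuous G -> G p @[p --> +oo] --> +oo -> G 0 = 0 -> 0 <= y ->
  exists2 q, 0 <= q & G q = y.
Proof.
move=> cG Gy G0 y0.
have [p p0 Gp] : exists2 p, 0 <= p & y <= G p.
  near (pinfty_nbhs R) => p; exists p; near: p; first exact: nbhs_pinfty_ge.
  by move/cvgryPge : Gy; exact.
have [q + Gq] : exists2 q, q \in `[0, p]%R & G q = y.
  apply: IVT => //; first exact: continuous_subspaceT.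
  by rewrite G0 ge_min y0 /= le_max Gp orbT.
by rewrite in_itv /= => /andP[q0 _]; exists q.
Unshelve. all: by end_near. Qed.

(** The value [y] is attained on the half-line, where [G] is injective, so the partial inverse
    returns the true preimage and not a default value. *)
Lemma G2inv_spec (R : realType) (G : R -> R) (y : R) :
  {in `[0, +oo[ &, {homo G : p q / p < q}} ->
  continuous G -> G p @[p --> +oo] --> +oo -> G 0 = 0 -> 0 <= y ->
  0 <= G2inv G y /\ G (G2inv G y) = y.
Proof.
move=> incG cG Gy G0 /(exists_nonneg_preimage cG Gy G0)[q q0 <-].
have qD : q \in (`[0, +oo[ : set R) by rewrite inE /= in_itv /= q0.
rewrite /G2inv pinvKV// => p1 p2 p1D p2D E.
by have [/(incG _ _ p1D p2D)|/(incG _ _ p2D p1D)|//] := ltgtP p1 p2;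
  rewrite E ltxx.
Qed.

Lemma G1inv_spec (R : realType) (G : R -> R) (y : R) :
  {in `]-oo, 0] &, {homo G : p q /~ p < q}} ->
  continuous G -> G p @[p --> -oo] --> +oo -> G 0 = 0 -> 0 <= y ->
  G1inv G y <= 0 /\ G (G1inv G y) = y.
Proof.
move=> decG cG Gy G0 y0.
have [q q0 Gq] : exists2 q, 0 <= q & G (- q) = y.
  apply: (@exists_nonneg_preimage _ (G \o -%R)) => //.
  - by move=> x; apply: continuous_comp; [exact: oppr_continuous | exact: cG].
  - exact: (cvgNy_compNP _ _).1.
  - by rewrite /= oppr0.
have qD : - q \in (`]-oo, 0] : set R) by rewrite inE /= in_itv /= oppr_le0.
rewrite -Gq /G1inv pinvKV ?oppr_le0// => p1 p2 p1D p2D E.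
by have [/(decG _ _ p2D p1D)|/(decG _ _ p1D p2D)|//] := ltgtP p1 p2;
  rewrite E ltxx.
Qed.

(** * Translation and reflection of profiles; the increasing and decreasing branches *)

Lemma bounded_profile_shift (R : realType) (b h G : R -> R) (A B t : R)
    (f : R -> R) :
  bounded_profile b h G A B f ->
  bounded_profile (fun x => b (x + t)) (fun x => h (x + t)) G A B
    (fun x => f (x + t)).
Proof.
move=> [df fAB]; split=> // x.
have := @is_derive1_comp R f (shift t) x _ _ (df (x + t)) (is_derive_shift x 1 t).
by rewrite mulr1.
Qed.

(** The two sign changes cancel in the derivative, while [G] is replaced by p |-> G (- p): a
    decreasing branch becomes an increasing one. *)
Lemma bounded_profile_reflect (R : realType) (b h G : R -> R) (A B : R)
    (f : R -> R) :
  bounded_profile b h G A B f ->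
  bounded_profile (b \o -%R) (h \o -%R) (G \o -%R) (- B) (- A)
    (fun x => - f (- x)).
Proof.
move=> [df fAB]; split=> x; last by rewrite !lerN2 andbC.
have d := @is_derive1_comp R f -%R x _ _ (df (- x)) (is_deriveNid x 1).
apply: (is_derive_eq (is_deriveN d)).
by rewrite /= opprK; ring.
Qed.

Lemma bounded_profile_increasing (R : realType) (b h G : R -> R) (A B : R) :
  A <= B -> (forall x, 1 <= b x) -> continuous b -> continuous h ->
  locally_lipschitz G ->
  (forall p q, A <= p -> p < q -> q <= B -> G p < G q) ->
  (forall x, G A <= h x <= G B) ->
  exists! f, bounded_profile b h G A B f.
Proof.
move=> AB b1 cb ch lipG incG hAB.
have cG := locally_lipschitz_continuous lipG.
have [K [K0 lipK]] := locally_lipschitz_segment A B lipG.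
have [|f Pf] := @bounded_profile_exists _ b h G K A B K0 AB b1 cb ch cG _ hAB.
  move=> p q Ap pq qB; apply: le_trans (ler_norm _) _.
  rewrite -[q - p]ger0_norm ?subr_ge0//; apply: lipK.
    by rewrite qB (le_trans Ap).
  by rewrite Ap (le_trans pq).
by exists f; split=> // g; exact: bounded_profile_unique.
Qed.

Lemma bounded_profile_decreasing (R : realType) (b h G : R -> R) (A B : R) :
  A <= B -> (forall x, 1 <= b x) -> continuous b -> continuous h ->
  locally_lipschitz G ->
  (forall p q, A <= p -> p < q -> q <= B -> G q < G p) ->
  (forall x, G B <= h x <= G A) ->
  exists! f, bounded_profile b h G A B f.
Proof.
move=> AB b1 cb ch lipG decG hAB.
have cN (f : R -> R) : continuous f -> continuous (f \o -%R).
  by move=> cf x; apply: continuous_comp; [exact: oppr_continuous | exact: cf].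
have lipGN : locally_lipschitz (G \o -%R).
  move=> p; have [U Up GU] := lipG (- p); exists (-%R @^-1` U).
    exact: (@opp_continuous R p _ Up).
  move: GU; rewrite /lipschitz_on; apply: filterS => M MU [x y] [/= Ux Uy].
  have := MU (- x, - y) (conj Ux Uy).
  by rewrite /self_sub /= -opprD normrN.
have [||||f [Pf f_unique]] := @bounded_profile_increasing _ (b \o -%R)
    (h \o -%R) (G \o -%R) (- B) (- A) _ _ (cN b cb) (cN h ch) lipGN.
- by rewrite lerN2.
- by move=> x; exact: b1.
- by move=> p q Bp pq qA; apply: decG; [rewrite lerNr | rewrite ltrN2 | rewrite lerNl].
- by move=> x; rewrite /= !opprK.
(* Reflection is an involution, so reflecting back restores [b], [h], [G] and the strip, and carries
   uniqueness over as well. *)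
exists (fun x => - f (- x)); split.
  have := bounded_profile_reflect Pf; rewrite !opprK.
  by congr bounded_profile; apply/funext => x /=; rewrite opprK.
move=> g /bounded_profile_reflect/f_unique ->; apply/funext => x.
by rewrite !opprK.
Qed.

(** * The second-order equation and stationarity *)

(** Common form of [F1_spec] and [F2_spec], which are instances of it by conversion, so both
    branches share the lemmas below. *)
Definition bounded_solution (R : realType) (Omega : Type) (beta : R)
    (G : R -> R) (a V : R -> Omega -> R) (lambda A B : R) (w : Omega)
    (F : R -> R) :=
  [/\ solution beta G a V lambda w F, F 0 = 0 &
      forall x, F^`()%classic x \in `[A, B]].

Lemma bounded_solution_profile (R : realType) (Omega : Type) (beta : R)
    (G : R -> R) (a V : R -> Omega -> R) (lambda A B : R) (w : Omega)
    (F : R -> R) :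
  (forall x, 0 < a x w) -> bounded_solution beta G a V lambda A B w F ->
  bounded_profile (fun x => (a x w)^-1) (fun x => lambda - beta * V x w) G A B
    F^`()%classic.
Proof.
move=> a0 [[[_ dF' _] eqF] _ F'AB]; split=> x; last first.
  by have := F'AB x; rewrite inE /= in_itv.
apply: DeriveDef; first exact: dF'.
rewrite -derive1E -(eqF x) derive1nS derive1n1; field.
by rewrite gt_eqF.
Qed.

(** The primitive of [f] vanishing at 0 works: its second derivative is (h - G f) / a, which is
    continuous because [a], [V], [G] and [f] are. *)
Lemma profile_bounded_solution (R : realType) (Omega : Type) (beta : R)
    (G : R -> R) (a V : R -> Omega -> R) (lambda A B : R) (w : Omega)
    (f : R -> R) :
  (forall x, 0 < a x w) -> continuous G -> continuous (a ^~ w) ->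
  continuous (V ^~ w) ->
  bounded_profile (fun x => (a x w)^-1) (fun x => lambda - beta * V x w) G A B
    f ->
  exists2 F, bounded_solution beta G a V lambda A B w F & F^`()%classic = f.
Proof.
move=> a0 cG ca cV [df fAB].
have cf := is_derive_continuous df.
have [F [F0 dF]] := exists_primitive cf.
have F'E : F^`()%classic = f.
  by apply/funext => x; rewrite derive1E derive_val.
have F''E : F^`(2)%classic =
    (fun x => (a x w)^-1 * (lambda - beta * V x w - G (f x))).
  apply/funext => x; rewrite derive1nS derive1n1 F'E derive1E.
  by rewrite (@derive_val _ _ _ _ _ _ _ (df x)).
exists F => //; split => //; last first.
  by move=> x; rewrite F'E inE /= in_itv fAB.
split; last first.
  by move=> x; rewrite F''E F'E mulVKf ?gt_eqF//; ring.
split.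
- by move=> x; exact: ex_derive.
- by move=> x; rewrite F'E; have := df x => dfx; exact: ex_derive.
- rewrite F''E => x; apply: cvgM.
    by apply: cvgV; [rewrite gt_eqF | exact: ca].
  apply: cvgB; last exact: continuous_comp (cf x) (cG _).
  apply: cvgB; first exact: cvg_cst.
  exact: cvgM (cvg_cst beta) (cV x).
Qed.

Lemma bounded_solution_exists_unique (R : realType) (Omega : Type) (beta : R)
    (G : R -> R) (a V : R -> Omega -> R) (lambda A B : R) (w : Omega) :
  (forall x, 0 < a x w) -> continuous G -> continuous (a ^~ w) ->
  continuous (V ^~ w) ->
  (exists! f, bounded_profile (fun x => (a x w)^-1)
    (fun x => lambda - beta * V x w) G A B f) ->
  exists! F, bounded_solution beta G a V lambda A B w F.
Proof.
move=> a0 cG ca cV [f [Pf f_unique]].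
have [F SF F'E] := profile_bounded_solution a0 cG ca cV Pf.
exists F; split=> // F2 SF2.
have F2'E : f = F2^`()%classic.
  by apply: f_unique; exact: bounded_solution_profile.
have [[[dF _ _] _] F0 _] := SF; have [[[dF2 _ _] _] F20 _] := SF2.
(* Both derivatives equal [f], so F - F2 is constant, and it vanishes at 0. *)
apply/funext => x; apply/eqP; rewrite -subr_eq0.
have d (y : R) : is_derive y 1 (F - F2) 0.
  have := is_deriveB (derivableP (dF y)) (derivableP (dF2 y)).
  by rewrite -!derive1E F'E F2'E subrr.
by have := is_derive_0_is_cst x 0 d; rewrite !fctE F0 F20 subrr => ->.
Qed.

Lemma bounded_solution_stationary (R : realType) (Omega : Type)
    (tau : R -> Omega -> Omega) (beta : R) (G : R -> R)
    (a V : R -> Omega -> R) (lambda A B : R) :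
  (forall x y, tau (x + y) = tau x \o tau y) ->
  stationary tau a -> stationary tau V -> (forall x w, 0 < a x w) ->
  (forall w, exists! f, bounded_profile (fun x => (a x w)^-1)
    (fun x => lambda - beta * V x w) G A B f) ->
  forall F : R -> Omega -> R,
    (forall w, bounded_solution beta G a V lambda A B w (F ^~ w)) ->
    stationary tau (fun x w => (F ^~ w)^`()%classic x).
Proof.
move=> tauD sa sV a0 uniq F SF x w.
(* Both sides equal f 0 (tau y (tau x w)) by the group law. *)
have shift (f : R -> Omega -> R) y : stationary tau f ->
    f (y + x) w = f y (tau x w).
  by move=> sf; rewrite sf tauD [RHS]sf.
have := bounded_profile_shift x (bounded_solution_profile (a0 ^~ w) (SF w)).
have -> : (fun y => (a (y + x) w)^-1) = (fun y => (a y (tau x w))^-1).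
  by apply/funext => y; rewrite shift.
have -> : (fun y => lambda - beta * V (y + x) w) =
    (fun y => lambda - beta * V y (tau x w)).
  by apply/funext => y; rewrite shift.
have [f [_ f_unique]] := uniq (tau x w).
move=> /f_unique fE.
have := bounded_solution_profile (a0 ^~ (tau x w)) (SF (tau x w)).
(* The profile for [w] translated by [x] is the profile for [tau x w]; evaluation at 0 gives the
   claim. *)
move=> /f_unique; rewrite fE => /(congr1 (@^~ 0)) /=.
by rewrite add0r.
Qed.

Theorem theorem2p1 (R : realType) (d : measure_display)
    (Omega : measurableType d) (P : probability Omega R)
    (tau : R -> Omega -> Omega)
    (tau_action : measurable_action tau)
    (tau_preserving : forall x, measure_preserving P (tau x))
    (P_ergodic : ergodic P tau)
    (beta : R) (beta_gt0 : 0 < beta)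
    (G : R -> R) (a V : R -> Omega -> R)
    (G_ge0 : forall p, 0 <= G p)
    (G_lipschitz : locally_lipschitz G)
    (G_ninfty : G p @[p --> -oo] --> +oo)
    (G_pinfty : G p @[p --> +oo] --> +oo)
    (G0 : G 0 = 0)
    (G1_decreasing : {in `]-oo, 0] &, {homo G : p q /~ p < q}})
    (G2_increasing : {in `[0, +oo[ &, {homo G : p q / p < q}})
    (a_range : forall x w, 0 < a x w <= 1)
    (V_range : forall x w, 0 <= V x w <= 1)
    (a_measurable : measurable_fun setT (a 0))
    (V_measurable : measurable_fun setT (V 0))
    (a_stationary : stationary tau a)
    (V_stationary : stationary tau V)
    (V_extrema : {ae P, forall w, inf (range (V ^~ w)) = 0 /\
                                  sup (range (V ^~ w)) = 1})
    (a_continuous : forall w, continuous (a ^~ w))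
    (V_continuous : forall w, continuous (V ^~ w)) :
  forall lambda : R, beta <= lambda ->
  [/\ (forall w, exists! F : R -> R, F1_spec beta G a V lambda w F),
      (forall w, exists! F : R -> R, F2_spec beta G a V lambda w F),
      (forall F1 : R -> Omega -> R,
         (forall w, F1_spec beta G a V lambda w (F1 ^~ w)) ->
         stationary tau (fun x w => (F1 ^~ w)^`()%classic x)) &
      (forall F2 : R -> Omega -> R,
         (forall w, F2_spec beta G a V lambda w (F2 ^~ w)) ->
         stationary tau (fun x w => (F2 ^~ w)^`()%classic x))].
Proof.
move=> lambda beta_le.
have [_ tauD _] := tau_action.
have cG := locally_lipschitz_continuous G_lipschitz.
have a0 x w : 0 < a x w by have /andP[] := a_range x w.
have b1 w x : 1 <= (a x w)^-1.
  by have /andP[? ?] := a_range x w; rewrite invf_ge1.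
have cb w : continuous (fun x => (a x w)^-1).
  by move=> x; apply: cvgV; [rewrite gt_eqF | exact: a_continuous].
have ch w : continuous (fun x => lambda - beta * V x w).
  move=> x; apply: cvgB; first exact: cvg_cst.
  exact: cvgM (cvg_cst beta) (V_continuous w x).
have h_range x w : lambda - beta <= lambda - beta * V x w <= lambda.
  have /andP[V0 V1] := V_range x w.
  by rewrite lerD2l lerN2 gerBl mulr_ge0 ?ler_piMr// ltW.
have lambda0 : 0 <= lambda by apply: le_trans beta_le; exact: ltW.
have lambda_beta0 : 0 <= lambda - beta by rewrite subr_ge0.
have lambda_lt : lambda - beta < lambda by rewrite gtrBl.
have [A1 GA1] := G1inv_spec G1_decreasing cG G_ninfty G0 lambda0.
have [B1 GB1] := G1inv_spec G1_decreasing cG G_ninfty G0 lambda_beta0.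
have [A2 GA2] := G2inv_spec G2_increasing cG G_pinfty G0 lambda_beta0.
have [B2 GB2] := G2inv_spec G2_increasing cG G_pinfty G0 lambda0.
have decG p q : p < q -> q <= 0 -> G q < G p.
  move=> pq q0; apply: G1_decreasing => //; rewrite inE /= in_itv //=.
  exact: le_trans (ltW pq) q0.
have incG p q : 0 <= p -> p < q -> G p < G q.
  move=> p0 pq; apply: G2_increasing => //; rewrite inE /= in_itv /= andbT//.
  exact: le_trans p0 (ltW pq).
have AB1 : G1inv G lambda <= G1inv G (lambda - beta).
  rewrite leNgt; apply/negP => /decG /(_ A1).
  by rewrite GA1 GB1 ltNge ltW.
have AB2 : G2inv G (lambda - beta) <= G2inv G lambda.
  rewrite leNgt; apply/negP => /(incG _ _ B2).
  by rewrite GA2 GB2 ltNge ltW.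
(* The range [lambda - beta, lambda] of h is bounded by the values of [G] at the strip ends, taken
   in reverse order on this decreasing branch. *)
have profile1 w : exists! f, bounded_profile (fun x => (a x w)^-1)
    (fun x => lambda - beta * V x w) G (G1inv G lambda)
    (G1inv G (lambda - beta)) f.
  apply: bounded_profile_decreasing => // [p q _ pq qB|x].
    by apply: decG => //; exact: le_trans B1.
  by rewrite GA1 GB1.
have profile2 w : exists! f, bounded_profile (fun x => (a x w)^-1)
    (fun x => lambda - beta * V x w) G (G2inv G (lambda - beta))
    (G2inv G lambda) f.
  apply: bounded_profile_increasing => // [p q Ap pq _|x].
    by apply: incG => //; exact: le_trans Ap.
  by rewrite GA2 GB2.
split.
- by move=> w; exact: bounded_solution_exists_unique.
- by move=> w; exact: bounded_solution_exists_unique.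
- exact: bounded_solution_stationary.
- exact: bounded_solution_stationary.
Qed.
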